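(* Let $E$ be an infinite-dimensional vector space and $I$ a countably infinite set. For every family $(e_i)_{i \in I} \in E^I$ and every map $\phi : I \to I$, let $P((e_i)_{i \in I},\phi)$ be the following proposition: if there exists a linear operator $T \in L(\mathrm{span}(e_i)_{i \in I},E)$ such that $T(e_i) = e_{\phi(i)}$ for all $i \in I$, and $\dim \mathrm{span}(e_i)_{i \in I} = +\infty$, then $(e_i)_{i \in I}$ is free. Then for every map $\phi : I \to I$, the following equivalence holds: $P((e_i)_{i \in I},\phi)$ is true for all $(e_i)_{i \in I} \in E^I$ if and only if there exists $a \in I$ such that $\mathrm{Orb}_\phi(a) = I$.
   Context: Vector spaces are over a field. $L(E,F)$ denotes the set of linear operators from $E$ to $F$. A family of vectors $(e_i)_{i\in I}$ is free if it is linearly independent (as a family). $\mathbb{N} = \{0,1,2,\dots\}$. For $\phi : I \to I$ and $a \in I$, $\mathrm{Orb}_\phi(a) = \{\phi^n(a) : n \in \mathbb{N}\}$ is the forward orbit of $a$, where $\phi^n$ is the $n$-fold composition of $\phi$ with itself and $\phi^0$ is the identity. *)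

(* Defs.v *)
From HB Require Import structures.
From mathcomp Require Import all_boot all_order all_algebra finmap.
From mathcomp Require Import boolp classical_sets functions cardinality.

Set Implicit Arguments.
Unset Strict Implicit.
Unset Printing Implicit Defensive.

Import GRing.Theory.

Local Open Scope classical_set_scope.
Local Open Scope ring_scope.

(* A linear combination is given by a list of pairs (coefficient, index);
   repeated indices are allowed. *)
Definition lin_comb (K : fieldType) (V : lmodType K) (I : Type) (e : I -> V)
  (s : seq (K * I)) : V := \sum_(p <- s) p.1 *: e p.2.

Definition family_span (K : fieldType) (V : lmodType K) (I : Type)
  (e : I -> V) : set V := range (lin_comb e).

Definition in_family_span (K : fieldType) (V : lmodType K) (I : Type)
  (e : I -> V) : {pred V} := [pred x | x \in family_span e].

Lemma in_family_spanP (K : fieldType) (V : lmodType K) (I : Type)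
  (e : I -> V) (x : V) : (x \in in_family_span e) <-> family_span e x.
Proof. by split=> [/set_mem|/mem_set]. Qed.

Lemma family_span_submod_closed (K : fieldType) (V : lmodType K) (I : Type)
  (e : I -> V) : submod_closed (in_family_span e).
Proof.
split; first by apply/in_family_spanP; exists [::]; rewrite ?/lin_comb ?big_nil.
move=> a x y /in_family_spanP[s _ <-] /in_family_spanP[t _ <-].
apply/in_family_spanP; exists ([seq (a * p.1, p.2) | p <- s] ++ t) => //.
rewrite /lin_comb big_cat big_map /= scaler_sumr; congr (_ + _).
by apply: eq_bigr => p _; rewrite scalerA.
Qed.

HB.instance Definition _ (K : fieldType) (V : lmodType K) (I : Type)
  (e : I -> V) := GRing.isSubmodClosed.Build K V (in_family_span e)
    (family_span_submod_closed e).

Record span_of (K : fieldType) (V : lmodType K) (I : Type) (e : I -> V) :=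
  SpanOf { span_val :> V; span_valP : span_val \in in_family_span e }.

Section SpanOfInstances.
Variables (K : fieldType) (V : lmodType K) (I : Type) (e : I -> V).
HB.instance Definition _ := [isSub for @span_val K V I e].
HB.instance Definition _ := [Choice of span_of e by <:].
HB.instance Definition _ := [SubChoice_isSubLmodule of span_of e by <:].
End SpanOfInstances.

Lemma mem_family_span (K : fieldType) (V : lmodType K) (I : Type)
  (e : I -> V) (i : I) : e i \in in_family_span e.
Proof.
apply/in_family_spanP; exists [:: (1, i)] => //.
by rewrite /lin_comb big_seq1 scale1r.
Qed.

Definition span_gen (K : fieldType) (V : lmodType K) (I : Type) (e : I -> V)
  (i : I) : span_of e := SpanOf (mem_family_span e i).

Definition infinite_dimensional (K : fieldType) (V : lmodType K) : Prop :=
  ~ exists (n : nat) (b : 'I_n -> V), family_span b = [set: V].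

Definition free_family (K : fieldType) (V : lmodType K) (I : choiceType)
  (e : I -> V) : Prop :=
  forall (A : {fset I}) (c : I -> K),
    \sum_(i <- A) c i *: e i = 0 -> forall i, i \in A -> c i = 0.

Definition forward_orbit (I : Type) (phi : I -> I) (a : I) : set I :=
  [set iter n phi a | n in [set: nat]].

Definition shift_implies_free (K : fieldType) (E : lmodType K)
  (I : choiceType) (e : I -> E) (phi : I -> I) : Prop :=
  (exists T : {linear span_of e -> E}, forall i, T (span_gen e i) = e (phi i)) /\
  infinite_dimensional (span_of e) ->
  free_family e.

(* Main.v *)
(** If the orbit of [a] is all of [I], a relation puts some e_i in the span F of
  the e_(phi^k a) coming before it; then F is T-stable and equals the whole span,
  which is thus finite-dimensional. Conversely, start from a free family g and
  collapse it along phi. If phi b = phi c with b <> c, replace g_b by g_c. If some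
  orbit has infinite complement, replace g by 0 on that orbit. Otherwise phi is
  injective with cofinite orbits, so any two orbits meet, hence are nested by
  cancellation, and the largest one is I. *)
From HB Require Import structures.
Require Import Defs.
From mathcomp Require Import all_boot all_order all_algebra.
From mathcomp Require Import finmap.
From mathcomp Require Import boolp classical_sets functions cardinality.

Set Implicit Arguments.
Unset Strict Implicit.
Unset Printing Implicit Defensive.

Import GRing.Theory.

Local Open Scope classical_set_scope.
Local Open Scope ring_scope.

(** * Linear combinations and linear maps on a span *)

Lemma lin_comb_cat (K : fieldType) (V : lmodType K) (I : Type) (e : I -> V)
    (s t : seq (K * I)) :
  lin_comb e (s ++ t) = lin_comb e s + lin_comb e t.
Proof. by rewrite /lin_comb big_cat. Qed.

Lemma lin_comb_scale (K : fieldType) (V : lmodType K) (I : Type) (e : I -> V)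
    (a : K) (s : seq (K * I)) :
  lin_comb e [seq (a * p.1, p.2) | p <- s] = a *: lin_comb e s.
Proof.
rewrite /lin_comb big_map scaler_sumr.
by apply: eq_bigr => p _; rewrite scalerA.
Qed.

(** Bridge between lists with repeated indices, as in [lin_comb], and sums over finite sets, as in
    [free_family]. *)
Lemma lin_comb_undup (K : fieldType) (V : lmodType K) (I : choiceType)
    (e : I -> V) (s : seq (K * I)) :
  lin_comb e s =
  \sum_(i <- [fset p.2 | p in s]%fset) (\sum_(p <- s | p.2 == i) p.1) *: e i.
Proof.
under [RHS]eq_bigr => i _ do rewrite scaler_suml.
rewrite (exchange_big_dep xpredT) //= /lin_comb.
rewrite big_seq_cond [RHS]big_seq_cond; apply: eq_bigr => p; rewrite andbT => ps.
rewrite big_mkcond (big_fsetD1 p.2) /=; last by apply/imfsetP; exists p.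
rewrite eqxx big1_fset ?addr0 // => i; rewrite !inE => /andP[ip _] _.
by rewrite eq_sym (negbTE ip).
Qed.

Lemma free_lin_comb0 (K : fieldType) (E V : lmodType K) (I : choiceType)
    (g : I -> E) (v : I -> V) (s : seq (K * I)) :
  free_family g -> lin_comb g s = 0 -> lin_comb v s = 0.
Proof.
rewrite !lin_comb_undup => gfree /gfree c0.
by rewrite big_seq big1 // => i /c0 ->; rewrite scale0r.
Qed.

Lemma span_val_lin_comb (K : fieldType) (V : lmodType K) (I J : Type)
    (e : I -> V) (b : J -> span_of e) (s : seq (K * J)) :
  span_val (lin_comb b s) = lin_comb (fun j => span_val (b j)) s.
Proof.
by rewrite /lin_comb; elim: s => [|p s IHs]; rewrite ?big_nil // !big_cons -IHs.
Qed.

(** Each vector is sent to the image of a chosen expansion in [e]. Two expansions differ by a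
    relation, which [v] also satisfies, so the choice does not matter. *)
Lemma linear_on_span (K : fieldType) (E V : lmodType K) (I : Type)
    (e : I -> E) (v : I -> V) :
  (forall s, lin_comb e s = 0 -> lin_comb v s = 0) ->
  exists T : {linear span_of e -> V}, forall i, T (span_gen e i) = v i.
Proof.
move=> rel.
have rel2 s t : lin_comb e s = lin_comb e t -> lin_comb v s = lin_comb v t.
  move=> st; apply/eqP; rewrite -subr_eq0 -scaleN1r -lin_comb_scale -lin_comb_cat.
  by rewrite rel // lin_comb_cat lin_comb_scale scaleN1r st subrr.
have /choice[r rP] (x : span_of e) : exists s, lin_comb e s = span_val x.
  by have /in_family_spanP[s _ sx] := span_valP x; exists s.
pose T x := lin_comb v (r x).
have Tlin : linear T.
  move=> a x y; rewrite /T -lin_comb_scale -lin_comb_cat; apply: rel2.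
  by rewrite lin_comb_cat lin_comb_scale !rP.
pose TL : {linear span_of e -> V} :=
  HB.pack T (GRing.isLinear.Build K (span_of e) V _ T Tlin).
exists TL => i; rewrite /= /T.
have -> : v i = lin_comb v [:: (1, i)] by rewrite /lin_comb big_seq1 scale1r.
by apply: rel2; rewrite rP /lin_comb big_seq1 scale1r.
Qed.

(** Solve a nontrivial relation for the index with the largest [n] among those with nonzero
    coefficient; injectivity of [n] puts the others strictly below. *)
Lemma not_free_top (K : fieldType) (E : lmodType K) (I : choiceType)
    (e : I -> E) (n : I -> nat) :
  injective n -> ~ free_family e ->
  exists i s, all (fun p => n p.2 < n i)%N s /\ e i = lin_comb e s.
Proof.
move=> n_inj /existsNP[A /existsNP[c /not_implyP[Ac0 /existsNP[j]]]].
move=> /not_implyP[jA /eqP cj].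
pose P k := has (fun i => (c i != 0) && (n i == k)) A.
have exP : exists k, P k by exists (n j); apply/hasP; exists j; rewrite ?cj ?eqxx.
have ubP k : P k -> (k <= \max_(i <- A) n i)%N.
  by move=> /hasP[i iA /andP[_ /eqP <-]]; exact: leq_bigmax_seq.
have [N /hasP[i iA /andP[ci /eqP niN]] maxN] := ex_maxnP exP ubP.
exists i, [seq (- ((c i)^-1 * c k), k) | k <- A & (k != i) && (c k != 0)].
split.
  rewrite all_map; apply/allP => k /=; rewrite mem_filter -andbA.
  case/and3P=> ki ck kA; rewrite ltn_neqAle (inj_eq n_inj) ki niN.
  by apply: maxN; apply/hasP; exists k; rewrite ?ck ?eqxx.
move: Ac0; rewrite (bigD1_seq i) ?fset_uniq //= => /eqP.
rewrite addr_eq0 => /eqP cei.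
rewrite -[LHS]scale1r -(mulVf ci) -scalerA cei /lin_comb big_map big_filter.
rewrite -sumrN scaler_sumr [RHS]big_mkcondr; apply: eq_bigr => k _ /=.
by case: eqVneq => [->|]; rewrite ?scale0r ?oppr0 ?scaler0 //
   scalerN scalerA scaleNr.
Qed.

(** * Dimension bound and existence of free families *)

Lemma lin_comb_fin (K : fieldType) (V : lmodType K) (I : finType)
    (e : I -> V) (s : seq (K * I)) :
  lin_comb e s = \sum_i (\sum_(p <- s | p.2 == i) p.1) *: e i.
Proof.
under [RHS]eq_bigr => i _ do rewrite scaler_suml.
rewrite (exchange_big_dep xpredT) //= /lin_comb; apply: eq_bigr => p _.
by rewrite (big_pred1 p.2) // => i; rewrite eq_sym.
Qed.

(** With more than [n] rows, the matrix of coordinates in [b] has a nonzero left kernel vector,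
    which is a relation on [B]. *)
Lemma free_card_le_span (K : fieldType) (V : lmodType K) (J : choiceType)
    (v : J -> V) (B : {fset J}) (n : nat) (b : 'I_n -> V) :
  family_span b = [set: V] ->
  (forall c : J -> K, \sum_(j <- B) c j *: v j = 0 ->
    forall j, j \in B -> c j = 0) ->
  (#|` B| <= n)%N.
Proof.
move=> b_span Bfree; rewrite leqNgt; apply/negP => ltnB.
have [x0 x0B] : exists x, x \in B.
  by apply/fset0Pn; rewrite -cardfs_gt0 (leq_trans _ ltnB).
have /choice[a aP] (x : V) : exists a : 'I_n -> K, x = \sum_k a k *: b k.
  have : family_span b x by rewrite b_span.
  by case=> s _ <-; rewrite lin_comb_fin; eexists.
pose M : 'M_(#|` B|, n) := \matrix_(i, k) a (v (nth x0 B i)) k.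
have : kermx M != 0.
  by rewrite kermx_eq0 -row_leq_rank -ltnNge (leq_ltn_trans (rank_leq_col M)).
case/rowV0Pn => u /sub_kermxP uM /eqP; apply.
have nthB (i : 'I_#|` B|) : nth x0 B i \in B by rewrite mem_nth.
(* [c] transports the row [u] to [J]; outside [B] the index is out of range and the value is 0. *)
pose c j := if insub (index j B) is Some i then u ord0 i else 0.
have cnth (i : 'I_#|` B|) : c (nth x0 B i) = u 0 i.
  by rewrite /c index_uniq ?fset_uniq // valK.
apply/rowP => i; rewrite mxE -cnth; apply: Bfree => //.
rewrite (big_nth x0) big_mkord.
under eq_bigr => j _ do rewrite cnth (aP (v _)) scaler_sumr.
rewrite exchange_big big1 //= => k _.
under eq_bigr => j _ do rewrite scalerA.
rewrite -scaler_suml [X in X *: _](_ : _ = (u *m M) 0 k).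
  by rewrite uM mxE scale0r.
by rewrite mxE; apply: eq_bigr => j _; rewrite mxE.
Qed.

Lemma lin_comb_mem_span (K : fieldType) (V : lmodType K) (I : eqType)
    (J : Type) (e : I -> V) (b : J -> V) (s : seq (K * I)) :
  (forall p, p \in s -> family_span b (e p.2)) -> family_span b (lin_comb e s).
Proof.
move=> es; apply/in_family_spanP; rewrite /lin_comb big_seq.
by apply: rpred_sum => p /es/in_family_spanP; exact: rpredZ.
Qed.

Lemma family_span_gen (K : fieldType) (V : lmodType K) (J : Type) (b : J -> V) j :
  family_span b (b j).
Proof. exact/in_family_spanP/mem_family_span. Qed.

(** Greedy choice: each new vector avoids the span of the finitely many earlier ones. *)
Lemma exists_free_family (K : fieldType) (E : lmodType K) (I : countType) :
  infinite_dimensional E -> exists g : I -> E, free_family g.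
Proof.
move=> Einf.
have /choice[f fP] (l : seq E) :
    exists x, ~ family_span (fun k : 'I_(size l) => nth 0 l k) x.
  apply: contrapT => /forallNP lE; apply: Einf.
  exists (size l), (fun k => nth 0 l k); apply/seteqP; split=> // x _.
  exact: contrapT (lE x).
pose L n := iter n (fun l => rcons l (f l)) [::].
have sL n : size (L n) = n by elim: n => //= n IHn; rewrite size_rcons IHn.
have nthL n k : (k < n)%N -> nth 0 (L n) k = f (L k).
  elim: n => // n IHn; rewrite ltnS leq_eqVlt nth_rcons sL.
  by case: ltngtP => [/IHn->//|//|->].
exists (fun i : I => f (L (choice.pickle i))); apply: contrapT.
(* A dependent family would have a vector in the span of those with smaller code, against the choice
   of [f]. *)
move=> /(not_free_top (pcan_inj (@choice.pickleK I)))[i [s [/allP lts hi]]].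
apply: (fP (L (choice.pickle i))); rewrite hi; apply: lin_comb_mem_span => p /lts ltp.
rewrite -(nthL (choice.pickle i)) //; move: ltp.
rewrite -{1}(sL (choice.pickle i)) => ltp.
exact: (family_span_gen _ (Ordinal ltp)).
Qed.

(** * Collapsed free families and cofinite orbits *)

Section Counterexample.
Variables (K : fieldType) (E : lmodType K) (I : choiceType).
(* Allowing both a scalar and a reindexing covers the two ways of collapsing g:
   vanishing on an orbit ([rho = id]) and merging two indices ([d = 1]). *)
Variables (g : I -> E) (phi rho : I -> I) (d : I -> K).
Hypothesis g_free : free_family g.

Let e i := d i *: g (rho i).

(** A relation on [e] is a relation [s'] on [g], so any family satisfies [s']; applied to
    [e \o phi], this makes the shift well defined. Agreement with [g] at infinitely many indices
    keeps the span infinite-dimensional. *)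
Lemma not_shift_implies_free :
  (forall i, e (phi i) = d i *: e (phi (rho i))) ->
  infinite_set [set i | e i = g i] ->
  ~ free_family e -> ~ shift_implies_free e phi.
Proof.
move=> e_phi e_inf e_nfree; apply: contra_not e_nfree; apply; split.
  apply: linear_on_span (e \o phi) _ => s es0.
  pose s' := [seq (p.1 * d p.2, rho p.2) | p <- s].
  suff -> : lin_comb (e \o phi) s = lin_comb (e \o phi) s'.
    apply: (free_lin_comb0 _ g_free); rewrite -es0 /lin_comb big_map.
    by apply: eq_bigr => p _; rewrite scalerA.
  rewrite /lin_comb big_map.
  by apply: eq_bigr => p _; rewrite -scalerA /= -e_phi.
(* At least [n.+1] independent vectors [e j = g j] would lie in a space spanned by [n]. *)
case=> n [b b_span]; have [B BJ] := infinite_set_fset n.+1 e_inf.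
apply/negP; rewrite -leqNgt; apply: (@free_card_le_span _ _ _ (span_gen e)) b_span _.
move=> c /(congr1 (@span_val _ _ _ e)) => c0; apply: g_free.
have <- : span_val (\sum_(j <- B) c j *: span_gen e j) = \sum_(j <- B) c j *: g j.
  rewrite (big_morph (@span_val _ _ _ e) (raddfD (val : span_of e -> E))
    (raddf0 (val : span_of e -> E))).
  by rewrite big_seq [RHS]big_seq; apply: eq_bigr => j jB; rewrite /= (BJ j jB).
by rewrite c0.
Qed.

End Counterexample.

(** Induction on the size of the complement: a point [b] missed by the orbit of [a] has a strictly
    larger orbit. *)
Lemma exists_full_orbit (I : choiceType) (phi : I -> I) :
  injective phi -> infinite_set [set: I] ->
  (forall i, finite_set (~` forward_orbit phi i)) ->
  exists i, forward_orbit phi i = [set: I].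
Proof.
move=> phi_inj Iinf cofin; have [a _] := infinite_setN0 Iinf.
have [n] := ubnP #|` fset_set (~` forward_orbit phi a)|.
elim: n a => // n IHn a; rewrite ltnS => cardn.
have [|/existsNP[b ba]] := pselect (forall b, forward_orbit phi a b).
  by move=> aT; exists a; apply/seteqP; split.
have [_ [[k _ <-] [m _ bm]]] : forward_orbit phi a `&` forward_orbit phi b !=set0.
  apply: infinite_setN0; apply: infinite_setIl; last exact: cofin.
  by rewrite -(setTI (forward_orbit _ _)); apply: infinite_setIl => //; exact: cofin.
(* Cancel [phi] on both sides of [bm]. Exhausting the side of [b] first would put [b] in the orbit
   of [a]. *)
have [l la] : exists l, iter l phi b = a.
  elim: k m bm => [|k IHk] [|m] bm; first by exists 0%N.
  - by exists m.+1.
  - by case: ba; exists k.+1.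
  - exact: IHk (phi_inj _ _ bm).
apply: (IHn b); apply: leq_trans cardn; apply: fproper_ltn_card.
rewrite fproperE; apply/andP; split.
  apply/fsubsetP => x.
  rewrite !in_fset_set ?inE // => xb [j _ aj].
  by apply: xb; exists (j + l)%N => //; rewrite iterD la.
apply/fsubsetPn; exists b; rewrite in_fset_set ?inE //.
by apply/negP => /asboolP; apply; exists 0%N.
Qed.

(** * Consequences of freeness, and the case of a full orbit *)

Lemma free_family_inj (K : fieldType) (E : lmodType K) (I : choiceType)
    (e : I -> E) : free_family e -> injective e.
Proof.
move=> efree b c ebc; apply/eqP; apply: contraPT (@oner_eq0 K) => bc /eqP; apply.
have := efree [fset b; c]%fset (fun k => if k == b then 1 else - 1).
move=> /(_ _ b); rewrite eqxx !inE eqxx; apply=> //.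
rewrite big_fsetU1 ?inE //= big_seq_fset1 eqxx eq_sym (negbTE bc).
by rewrite ebc scale1r scaleN1r subrr.
Qed.

Lemma free_family_neq0 (K : fieldType) (E : lmodType K) (I : choiceType)
    (e : I -> E) i : free_family e -> e i <> 0.
Proof.
move=> efree ei0; have /eqP := oner_neq0 K; apply.
have := efree [fset i]%fset (fun=> 1); move=> /(_ _ i); apply; rewrite ?inE //.
by rewrite big_seq_fset1 ei0 scaler0.
Qed.

Lemma full_orbit_shift_implies_free (K : fieldType) (E : lmodType K)
    (I : choiceType) (e : I -> E) (phi : I -> I) (a : I) :
  forward_orbit phi a = [set: I] -> shift_implies_free e phi.
Proof.
move=> orbT [[T Te] e_inf]; apply: contrapT => e_nfree; apply: e_inf.
have /choice[n nP] i : exists n, iter n phi a = i.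
  have : forward_orbit phi a i by rewrite orbT.
  by case=> n _ <-; exists n.
have n_inj : injective n by move=> i j ij; rewrite -(nP i) ij nP.
have [i [s [/allP lts ei]]] := not_free_top n_inj e_nfree.
(* [b] lives in the span, where finite dimension is to be shown; [F] is its image in [E], where [T]
   takes values. *)
pose b (k : 'I_(n i)) := span_gen e (iter k phi a).
pose F := family_span (fun k => span_val (b k)).
have F_lt m : (m < n i)%N -> F (e (iter m phi a)).
  by move=> mn; exact: (family_span_gen _ (Ordinal mn)).
(* The boundary case [m = n i] is the relation [ei]; it gives the one extra step that stability
   under [T] needs. *)
have F_le m : (m <= n i)%N -> F (e (iter m phi a)).
  rewrite leq_eqVlt => /predU1P[->|/F_lt//]; rewrite nP ei.
  by apply: lin_comb_mem_span => p /lts /F_lt; rewrite nP.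
have F_T (x : span_of e) : F (span_val x) -> F (T x).
  case=> r _ rx; have -> : x = lin_comb b r.
    by apply: val_inj; rewrite /= span_val_lin_comb.
  rewrite /lin_comb raddf_sum; apply/in_family_spanP; apply: rpred_sum => p _.
  by rewrite /= linearZ rpredZ // Te; apply/in_family_spanP; exact: (F_le p.2.+1).
have F_iter m : F (e (iter m phi a)).
  by elim: m => [|m IHm]; [exact: F_le | rewrite iterS -Te; exact: F_T].
exists (n i), b; apply/seteqP; split=> // x _.
have [t _ tx] := (in_family_spanP _ _).1 (span_valP x).
have : F (span_val x).
  by rewrite -tx; apply: lin_comb_mem_span => p _; rewrite -(nP p.2); exact: F_iter.
case=> r _ rx; exists r => //; apply: val_inj => /=.
by rewrite span_val_lin_comb.
Qed.

Unset Implicit Arguments.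

Theorem proposition5p1 (K : fieldType) (E : lmodType K) (I : countType)
  (hE : infinite_dimensional E) (hI : infinite_set [set: I]) :
  forall phi : I -> I,
    (forall e : I -> E, shift_implies_free e phi) <->
    (exists a : I, forward_orbit phi a = [set: I]).
Proof.
move=> phi; split=> [P|[a aT] e]; last exact: full_orbit_shift_implies_free aT.
have [g g_free] := exists_free_family I hE.
have [phi_inj|] := pselect (injective phi).
  apply: exists_full_orbit => // a; apply: contrapT => a_inf.
  (* Killing [g] on the orbit is compatible with the shift because [phi] maps the orbit into itself;
     off the orbit [e] is still [g]. *)
  pose d i : K := if `[< forward_orbit phi a i >] then 0 else 1.
  have d0 i : forward_orbit phi a i -> d i = 0 by move=> ai; rewrite /d asboolT.
  have d1 i : ~ forward_orbit phi a i -> d i = 1 by move=> ai; rewrite /d asboolF.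
  apply: (@not_shift_implies_free _ _ _ g phi id d g_free _ _ _ (P _)) => [i||].
  - have [ai|/d1 ->] := pselect (forward_orbit phi a i); last by rewrite scale1r.
    rewrite !d0 ?scale0r //.
    by case: ai => n _ <-; exists n.+1.
  - by apply: sub_infinite_set a_inf => i /d1 /= ->; rewrite scale1r.
  - move=> /(@free_family_neq0 _ _ _ _ a); apply.
    by rewrite d0 ?scale0r //; exists 0%N.
move=> /existsNP[b /existsNP[c /not_implyP[bc_phi bc]]].
(* Replacing [b] by [c] is invisible after [phi], since [phi b = phi c], and changes [g] at [b]
   only. *)
pose rho i := if i == b then c else i.
exfalso; apply: (@not_shift_implies_free _ _ _ g phi rho (fun=> 1) g_free _ _ _ (P _)) => [i||].
- by rewrite !scale1r /rho; case: (i =P b) => [->|//]; rewrite bc_phi.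
- apply: sub_infinite_set (infinite_setD hI (finite_set1 b)) => i [_ /eqP ib] /=.
  by rewrite scale1r /rho (negbTE ib).
- by move=> /free_family_inj e_inj; apply/bc/e_inj; rewrite /rho eqxx if_same.
Qed.
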